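(* Let $\mathbb{F}=\mathbb{F}_q$ be a finite field, $\hat{\mathbb{F}}=\mathbb{F}_{q^r}$ a finite field extension of $\mathbb{F}$, and $n\in\mathbb{N}$. Let $\mathcal{C}\subseteq\hat{\mathbb{F}}^n$ be an $\mathbb{F}$-subspace of $\hat{\mathbb{F}}^n$ and let $f:\mathcal{C}\longrightarrow\hat{\mathbb{F}}^n$ be an $\mathbb{F}$-linear map that preserves the RT-weight on $\hat{\mathbb{F}}^n$. Then $f$ extends to an RT-weight-preserving $\mathbb{F}$-linear map on $\hat{\mathbb{F}}^n$.
   Context: The Rosenbloom-Tsfasman weight (RT-weight) of $v=(v_1,\ldots,v_n)\in\hat{\mathbb{F}}^n$ is $\mathrm{wt}_{\mathrm{RT}}(v)=0$ if $v=0$ and $\mathrm{wt}_{\mathrm{RT}}(v)=\max\{i\mid v_i\neq0\}$ otherwise. A map $f$ preserves the RT-weight if $\mathrm{wt}_{\mathrm{RT}}(f(v))=\mathrm{wt}_{\mathrm{RT}}(v)$ for all $v$ in its domain. *)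

(* Defs.v *)
From HB Require Import structures.
From mathcomp Require Import all_boot all_order all_algebra all_field.

Set Implicit Arguments.
Unset Strict Implicit.
Unset Printing Implicit Defensive.

Import GRing.Theory.
Local Open Scope ring_scope.

(* Vectors are finite functions 'I_n -> L rather than 'rV[L]_n: for an
   extension L of F, the former form a vector space over the base field F,
   while the row vectors only carry the scaling by L. *)

(* Coordinates are numbered from 1 in the weight, hence i.+1 for i : 'I_n. *)
Definition rt_weight (R : nmodType) (n : nat) (v : {ffun 'I_n -> R}) : nat :=
  if v == 0 then 0%N else \max_(i < n | v i != 0) i.+1.

Definition rt_preserving (F : fieldType) (L : fieldExtType F) (n : nat)
    (C : {vspace {ffun 'I_n -> L}})
    (f : 'Hom(subvs_of C, {ffun 'I_n -> L})) : Prop :=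
  forall v : subvs_of C, rt_weight (f v) = rt_weight (vsval v).

(* Main.v *)
(** A linear map preserves the RT-weight iff it preserves and reflects
  membership in every term [U k] = {vectors of weight <= k} of a flag.  Such a map can be
  extended by one dimension at a time: if [j + 1] is the least index with
  [U (j + 1)] not inside the domain [C], pick [v] in [U (j + 1)] outside [C] and
  send it to any [w] in [U (j + 1)] outside [f (C :&: U (j + 1))], which exists
  for dimension reasons since [f] is injective.  As [U j = f (U j)] lies in that
  image, the extension still reflects the flag. *)

Require Import Defs.
From HB Require Import structures.
From mathcomp Require Import all_boot all_order all_algebra all_field.

Set Implicit Arguments.
Unset Strict Implicit.
Unset Printing Implicit Defensive.

Import GRing.Theory.
Local Open Scope ring_scope.

(** The coordinate along [v] is a linear form on all of [vT] with value 1 at [v]; multiply it by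
    [w]. *)
Lemma linfun_line (K : fieldType) (vT : vectType K) (v w : vT) :
  v != 0 -> exists h : 'End(vT), h v = w.
Proof.
move=> v0.
pose c (x : vT) := coord [tuple v] ord0 x *: w.
have lin : linear c.
  by move=> a x y; rewrite /c linearP scalerDl scalerA.
pose hM := GRing.isLinear.Build K vT vT *:%R c lin.
pose h : {linear vT -> vT} := HB.pack c hM.
exists (linfun h); rewrite lfunE /= /c -[X in coord _ _ X]/([:: v]`_(@ord0 0)).
by rewrite (coord_free ord0) ?eqxx ?scale1r // /free span_seq1 dim_vline v0.
Qed.

(** The sum of [C] and the line of [v] is direct, so [f] on [C] and a map sending [v] to [w] are
    glued through the two projections. *)
Lemma lfun_extend1 (K : fieldType) (vT : vectType K) (C : {vspace vT})
    (f : 'End(vT)) (v w : vT) :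
  v \notin C ->
  exists g : 'End(vT), {in C, g =1 f} /\ g v = w.
Proof.
move=> vC.
have v0 : v != 0 by apply: contraNneq vC => ->; rewrite mem0v.
have [h hv] := linfun_line w v0.
have Cv : (C :&: <[v]> = 0)%VS.
  apply/eqP; rewrite -subv0; apply/subvP => x /memv_capP[xC /vlineP[a def_x]].
  rewrite memv0 def_x; case: (eqVneq a 0) => [->|a0]; first by rewrite scale0r.
  by rewrite def_x rpredZeq (negPf a0) (negPf vC) in xC.
have vC0 : (<[v]> :&: C = 0)%VS by rewrite capvC.
exists ((f \o daddv_pi C <[v]>) + (h \o daddv_pi <[v]> C))%VF; split=> [x xC|].
  have := daddv_pi_add Cv (subvP (addvSl _ _) _ xC).
  rewrite add_lfunE !comp_lfunE /= daddv_pi_id //.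
  by move/eqP; rewrite -subr_eq0 addrC addKr => /eqP->; rewrite linear0 addr0.
have := daddv_pi_add Cv (subvP (addvSr _ _) _ (memv_line v)).
rewrite add_lfunE !comp_lfunE /= (daddv_pi_id vC0) ?memv_line //.
move/eqP; rewrite -subr_eq0 addrK => /eqP->.
by rewrite linear0 add0r.
Qed.

(** Partial maps are encoded as endomorphisms of which only the values on [C] matter, so that the
    domain can grow without a change of type. *)
Definition flag_preserving (K : fieldType) (vT : vectType K)
    (U : nat -> {vspace vT}) (C : {vspace vT}) (f : 'End(vT)) :=
  forall c, c \in C -> forall k, (f c \in U k) = (c \in U k).

Section FlagExtension.
Variables (K : fieldType) (vT : vectType K) (U : nat -> {vspace vT}) (n : nat).
Hypotheses (U0 : U 0%N = 0%VS) (Un : U n = fullv).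
Hypothesis U_mono : forall j k, (j <= k)%N -> (U j <= U k)%VS.

Lemma flag_step (C : {vspace vT}) (f : 'End(vT)) :
  C != fullv -> flag_preserving U C f ->
  exists v (g : 'End(vT)),
    [/\ v \notin C, {in C, g =1 f} & flag_preserving U (C + <[v]>) g].
Proof.
move=> Cfull fU.
have ex_k : exists k, ~~ (U k <= C)%VS.
  by exists n; apply: contraNN Cfull; rewrite Un eqEsubv subvf.
case: (ex_minnP ex_k) => -[|j]; first by rewrite U0 sub0v.
move=> kC min_k.
have UjC : (U j <= C)%VS by apply: contraT => /min_k; rewrite ltnn.
have [v vU vC] := subvPn kC.
(* Reflecting [U 0 = 0] makes [f] injective on [C]. *)
have ker0 (A : {vspace vT}) : (A <= C)%VS -> (A :&: lker f = 0)%VS.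
  move=> AC; apply/eqP; rewrite -subv0; apply/subvP => x.
  case/memv_capP=> /(subvP AC) xC; rewrite memv_ker => /eqP fx0.
  by rewrite -U0 -fU // fx0 mem0v.
have fUj : (f @: U j = U j)%VS.
  apply/eqP; rewrite eqEdim limg_dim_eq ?ker0 // leqnn andbT.
  by apply/subvP => _ /memv_imgP[x xU ->]; rewrite fU // (subvP UjC).
have [w wU wI] : exists2 w, w \in U j.+1 & w \notin (f @: (C :&: U j.+1))%VS.
  apply/subvPn/negP => /dimvS; rewrite limg_dim_eq ?ker0 ?capvSl // => dimU.
  have /eqP eqU : (C :&: U j.+1 == U j.+1)%VS by rewrite eqEdim capvSr.
  by move/negP: vC; apply; rewrite -eqU in vU; case/memv_capP: vU.
have [g [gC gv]] := lfun_extend1 f w vC.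
exists v, g; split=> // _ /memv_addP[c cC [_ /vlineP[a ->] ->]] m.
rewrite linearD linearZ /= gC // gv.
have [->|a0] := eqVneq a 0; first by rewrite !scale0r !addr0 fU.
(* For [m > j], both [v] and [w] lie in [U m], so membership depends on [c] alone. For [m <= j],
   both memberships fail. *)
have [km|mj] := ltnP j m.
  by rewrite !rpredDr ?rpredZ ?fU // (subvP (U_mono km)).
apply/idP/idP => /(subvP (U_mono mj)) => [|/(subvP UjC)]; last first.
  by rewrite rpredDl // rpredZeq (negPf a0) (negPf vC).
(* From [f c + a *: w = f d], solving for [w] gives a preimage in [C]. It lies in [U j.+1] because
   [w] does and [f] reflects the flag, against the choice of [w]. *)
rewrite -fUj => /memv_imgP[d dU def_d]; case/negP: wI.
have dC := subvP UjC _ dU.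
have def_w : w = f (a^-1 *: (d - c)).
  by rewrite linearZ linearB /= -def_d addrC addKr scalerA mulVf ?scale1r.
have dcC : a^-1 *: (d - c) \in C by rewrite rpredZ ?rpredB.
by rewrite def_w memv_img // memv_cap dcC -fU // -def_w.
Qed.

Lemma flag_extension (C : {vspace vT}) (f : 'End(vT)) :
  flag_preserving U C f ->
  exists2 g : 'End(vT), {in C, g =1 f} & flag_preserving U fullv g.
Proof.
(* Induction on the codimension of [C]. *)
have [d] := ubnP (\dim {:vT} - \dim C); elim: d C f => // d IH C f ltd fU.
have [Cfull|Cfull] := eqVneq C fullv; first by exists f => //; rewrite -Cfull.
have [v [g [vC gf gU]]] := flag_step Cfull fU.
have [|h hg hU] := IH _ _ _ gU.
  have ltC : (\dim C < \dim (C + <[v]>))%N.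
    rewrite (ltn_leqif (dimv_leqif_sup (addvSl _ _))).
    by apply: contra vC => /subvP; apply; rewrite memvE addvSr.
  rewrite ltnS in ltd; apply: leq_trans ltd.
  by rewrite ltn_sub2l // (leq_trans ltC) // dimvS ?subvf.
by exists h => // c cC; rewrite hg ?gf // (subvP (addvSl _ _)).
Qed.

End FlagExtension.

(** Turns the maximum into linear conditions. Index [i] contributes [i.+1], so the bound [k] already
    excludes a nonzero entry at [i = k]. *)
Lemma rt_weight_leP (R : nmodType) n (v : {ffun 'I_n -> R}) k :
  reflect (forall i : 'I_n, (k <= i)%N -> v i = 0) (rt_weight v <= k)%N.
Proof.
rewrite /rt_weight; case: eqVneq => [->|_].
  by apply: ReflectT => i _; rewrite ffunE.
apply: (iffP (bigmax_leqP _ _ _)) => [le_k i ki|v0 i vi].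
  by apply: contraTeq ki => /le_k; rewrite ltnNge.
by rewrite ltnNge; apply: contra vi => /v0->.
Qed.

Section WeightFlag.
Variables (F : fieldType) (L : fieldExtType F) (n : nat).

Definition tail (k : nat) (v : {ffun 'I_n -> L}) : {ffun 'I_n -> L} :=
  [ffun i : 'I_n => if (k <= i)%N then v i else 0].

Fact tail_is_linear k : linear (tail k).
Proof.
move=> a u v; apply/ffunP => i; rewrite !ffunE.
by case: ifP => _; rewrite ?ffunE // scaler0 addr0.
Qed.
HB.instance Definition _ k :=
  GRing.isLinear.Build F {ffun 'I_n -> L} {ffun 'I_n -> L} *:%R (tail k)
    (tail_is_linear k).

(** As a kernel, the set of vectors of weight at most [k] is a subspace over [F] by construction. *)
Definition weight_flag (k : nat) : {vspace {ffun 'I_n -> L}} :=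
  lker (linfun (tail k)).

Lemma mem_weight_flag k v : (v \in weight_flag k) = (rt_weight v <= k)%N.
Proof.
rewrite memv_ker lfunE /=; apply/eqP/rt_weight_leP => [t0 i ki|v0].
  by move/ffunP/(_ i): t0; rewrite !ffunE ki.
by apply/ffunP => i; rewrite !ffunE; case: ifP => // /v0.
Qed.

End WeightFlag.

Theorem theorem5p1 (F : finFieldType) (L : fieldExtType F) (n : nat)
    (C : {vspace {ffun 'I_n -> L}})
    (f : 'Hom(subvs_of C, {ffun 'I_n -> L}))
    (f_rt : rt_preserving f) :
  exists g : 'End({ffun 'I_n -> L}),
    (forall v : subvs_of C, g (vsval v) = f v) /\
    (forall v : {ffun 'I_n -> L}, rt_weight (g v) = rt_weight v).
Proof.
(* Precomposing with a projection to [C] turns [f] into an endomorphism that agrees with it on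
   [C]. *)
pose f0 := (f \o linfun (vsproj C))%VF.
have f0E (v : subvs_of C) : f0 (vsval v) = f v.
  by rewrite comp_lfunE lfunE /= vsvalK.
have f0U : flag_preserving (@weight_flag F L n) C f0.
  by move=> c cC k; rewrite -(vsprojK cC) f0E !mem_weight_flag f_rt.
have [||j k jk|g gf gU] := flag_extension (n := n) _ _ _ f0U.
- apply/eqP; rewrite -subv0; apply/subvP => v.
  rewrite mem_weight_flag memv0 => /rt_weight_leP v0.
  by apply/eqP/ffunP => i; rewrite v0 ?ffunE.
- apply/eqP; rewrite eqEsubv subvf; apply/subvP => v _.
  by rewrite mem_weight_flag; apply/rt_weight_leP => i; rewrite leqNgt ltn_ord.
- by apply/subvP => v; rewrite !mem_weight_flag => /leq_trans; apply.
exists g; split=> v; first by rewrite gf ?subvsP ?f0E.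
(* Two weights with the same upper bounds are equal: take each of them as [k]. *)
have gE k : (rt_weight (g v) <= k)%N = (rt_weight v <= k)%N.
  by rewrite -!mem_weight_flag gU ?memvf.
by apply/eqP; rewrite eqn_leq gE leqnn -gE leqnn.
Qed.
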